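(* Let $(R,\mathfrak m)$ be a $d$-dimensional complete unramified regular local ring of mixed characteristic. Let $(S,\mathfrak n)$ be a ramified complete regular local ring obtained as an Eisenstein extension $S=R[X]/f(X)R[X]$ of $R$, where $f(X)\in R[X]$ is the Eisenstein polynomial. Then: (1) If the residue field of $S$ is separably closed, then so is the residue field of $R$. (2) Let $\mathfrak p$ be a prime ideal of $R$. If the image of the Eisenstein polynomial $f(X)\in R[X]$ is prime in the ring $(R/\mathfrak p)[X]$, then $\mathfrak pS$ is a prime ideal of $S$. (3) For every ideal $J\subset R$, $\dim(S/JS)=\dim(R/J)$. (4) For every ideal $J\subset R$, with $I=JS$: if the punctured spectrum of $S/I$ is connected, then the punctured spectrum of $R/J$ is also connected.
   Context: A local ring $(R,\mathfrak m)$ of mixed characteristic with residue characteristic $p>0$ is called unramified if $p\notin\mathfrak m^2$ and ramified if $p\in\mathfrak m^2$. For a normal local ring $(R,\mathfrak m)$, an Eisenstein polynomial over $R$ is a polynomial $f(X)=X^n+a_1X^{n-1}+\cdots+a_n\in R[X]$ with $a_i\in\mathfrak m$ for every $i=1,\dots,n$ and $a_n\notin\mathfrak m^2$; the ring $S=R[X]/f(X)R[X]$, which is local, is called an Eisenstein extension of $R$. The punctured spectrum of a local ring is its prime spectrum with the closed point (the maximal ideal) removed. *)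

(* Defs.v *)
From HB Require Import structures.
From mathcomp Require Import all_boot all_order all_algebra all_field.
From mathcomp Require Import generic_quotient ring_quotient qpoly separable.
From mathcomp Require Import boolp classical_sets constructive_ereal.
From mathcomp Require Import topology.

Set Implicit Arguments.
Unset Strict Implicit.
Unset Printing Implicit Defensive.

Import Order.TTheory GRing.Theory.

Local Open Scope classical_set_scope.
Local Open Scope ring_scope.
Local Open Scope quotient_scope.

(* The ideals of [ring_quotient] are proper by definition and live over        *)
(* nontrivial rings. Arbitrary ideals are needed here, and so is the zero ring *)
(* (as the quotient by the unit ideal), hence Prop-valued ideals of possibly   *)
(* trivial commutative rings.                                                  *)
Definition ideal_closed (R : comPzRingType) (I : set R) : Prop :=
  [/\ I 0, forall x y, I x -> I y -> I (x + y) & forall a x, I x -> I (a * x)].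

Definition prime_closed (R : comPzRingType) (P : set R) : Prop :=
  [/\ ideal_closed P, ~ P 1 & forall x y, P (x * y) -> P x \/ P y].

Definition max_closed (R : comPzRingType) (M : set R) : Prop :=
  [/\ ideal_closed M, ~ M 1
    & forall I, ideal_closed I -> ~ I 1 -> M `<=` I -> I = M].

Lemma max_closed_inv (R : comPzRingType) (M : set R) (x : R) :
  max_closed M -> ~ M x -> exists a, M (1 - a * x).
Proof.
move=> [[M0 MD MM] M1 Mmax] nMx.
pose I := [set z | exists a, M (z - a * x)].
have [//|nI1] := pselect (I 1).
case: nMx; have <- : I = M; last by exists 1; rewrite mul1r subrr.
apply: Mmax => //; last by move=> z Mz; exists 0; rewrite mul0r subr0.
split; first by exists 0; rewrite mul0r subr0.
- move=> y z [a Ma] [b Mb]; exists (a + b).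
  by rewrite mulrDl opprD addrACA; exact: MD.
- by move=> c z [a Ma]; exists (c * a); rewrite -mulrA -mulrBr; exact: MM.
Qed.

Lemma max_prime_closed (R : comPzRingType) (M : set R) :
  max_closed M -> prime_closed M.
Proof.
move=> maxM; have [[M0 MD MM] M1 _] := maxM; split=> // x y Mxy.
have [Mx|nMx] := pselect (M x); [by left | right].
have [a Ma] := max_closed_inv maxM nMx.
have -> : y = y * (1 - a * x) + a * (x * y).
  by rewrite mulrBr mulr1 mulrA [y * (a * x)]mulrC subrK.
by apply: MD; exact: MM.
Qed.

Record ideal (R : comPzRingType) := Ideal {
  ideal_set :> set R;
  idealP : ideal_closed ideal_set }.

Record primeIdeal (R : comPzRingType) := PrimeIdeal {
  prime_set : set R;
  primeIdealP : prime_closed prime_set }.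

Record maxIdeal (R : comPzRingType) := MaxIdeal {
  max_set : set R;
  maxIdealP : max_closed max_set }.

Fact prime_ideal_closed (R : comPzRingType) (P : primeIdeal R) :
  ideal_closed (prime_set P).
Proof. by case: (primeIdealP P). Qed.

Coercion prime_ideal (R : comPzRingType) (P : primeIdeal R) : ideal R :=
  Ideal (prime_ideal_closed P).

Coercion max_primeIdeal (R : comPzRingType) (M : maxIdeal R) : primeIdeal R :=
  PrimeIdeal (max_prime_closed (maxIdealP M)).

Section Quotient.
Variables (R : comPzRingType) (I : ideal R).

Definition ideal_pred : {pred R} := fun x => `[< ideal_set I x >].

Fact ideal_pred_zmod : zmod_closed ideal_pred.
Proof.
have [I0 ID IM] := idealP I; split; first exact/asboolP.
move=> x y /asboolP Ix /asboolP Iy; apply/asboolP; apply: ID => //.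
by rewrite -mulN1r; exact: IM.
Qed.
HB.instance Definition _ := GRing.isZmodClosed.Build R ideal_pred ideal_pred_zmod.

(* R / I; it is the zero ring when I is the unit ideal. *)
Definition quot : Type := Quotient.quot ideal_pred.
HB.instance Definition _ := GRing.Zmodule.on quot.
HB.instance Definition _ := EqQuotient.on quot.

Definition quot_one : quot := \pi_quot 1.
Definition quot_mul (x y : quot) : quot := \pi_quot (repr x * repr y).

Lemma quot_eqP (x y : R) : \pi_quot x = \pi_quot y <-> ideal_set I (x - y).
Proof.
have -> : (\pi_quot x = \pi_quot y) <-> (\pi_quot x == \pi_quot y).
  by split=> /eqP.
by rewrite -(@Quotient.idealrBE R ideal_pred); split=> /asboolP.
Qed.

Lemma quot_piM : {morph \pi_quot : x y / x * y >-> quot_mul x y}.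
Proof.
move=> x y; have [I0 ID IM] := idealP I; apply/quot_eqP.
have /quot_eqP hx : \pi_quot x = \pi_quot (repr (\pi_quot x)) by rewrite reprK.
have /quot_eqP hy : \pi_quot y = \pi_quot (repr (\pi_quot y)) by rewrite reprK.
set x' := repr _ in hx *; set y' := repr _ in hy *.
have -> : x * y - x' * y' = y * (x - x') + x' * (y - y').
  by rewrite !mulrBr [y * x]mulrC [y * x']mulrC addrA subrK.
by apply: ID; exact: IM.
Qed.

Lemma quot_piD : {morph \pi_quot : x y / x + y >-> x + y}.
Proof. exact: (@Quotient.pi_add R ideal_pred). Qed.

Fact quot_mulA : associative quot_mul.
Proof.
move=> x y z; rewrite -[x]reprK -[y]reprK -[z]reprK.
move: (repr x) (repr y) (repr z) => a b c.
by rewrite -(quot_piM b c) -(quot_piM a b) -(quot_piM a) -(quot_piM _ c) mulrA.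
Qed.
Fact quot_mulC : commutative quot_mul.
Proof. by move=> x y; rewrite /quot_mul mulrC. Qed.
Fact quot_mul1 : left_id quot_one quot_mul.
Proof.
by move=> x; rewrite -[x]reprK; move: (repr x) => a; rewrite -(quot_piM 1) mul1r.
Qed.
Fact quot_mulDl : left_distributive quot_mul +%R.
Proof.
move=> x y z; rewrite -[x]reprK -[y]reprK -[z]reprK.
move: (repr x) (repr y) (repr z) => a b c.
by rewrite -(quot_piM a c) -(quot_piM b c) -!quot_piD -quot_piM mulrDl.
Qed.
HB.instance Definition _ :=
  GRing.Zmodule_isComPzRing.Build quot quot_mulA quot_mulC quot_mul1 quot_mulDl.

Definition proj (x : R) : quot := \pi_quot x.

Fact proj_zmod_morphism : zmod_morphism proj.
Proof.
move=> x y; apply: (addIr (proj y)); rewrite subrK.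
by rewrite -(quot_piD (x - y)) subrK.
Qed.
HB.instance Definition _ := GRing.isZmodMorphism.Build R quot proj
  proj_zmod_morphism.

Fact proj_monoid_morphism : monoid_morphism proj.
Proof. by split=> // x y; exact: quot_piM. Qed.
HB.instance Definition _ := GRing.isMonoidMorphism.Build R quot proj
  proj_monoid_morphism.

Lemma proj_eq0 (x : R) : proj x = 0 <-> ideal_set I x.
Proof. by rewrite -(raddf0 proj) quot_eqP subr0. Qed.

Lemma proj_surj (y : quot) : exists x, proj x = y.
Proof. by exists (repr y); rewrite /proj reprK. Qed.
End Quotient.

Section QuotientByPrime.
Variables (R : comPzRingType) (P : primeIdeal R).

Fact quot_prime_neq0 : 1 != 0 :> quot P.
Proof.
by apply/eqP => /proj_eq0; case: (primeIdealP P).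
Qed.
HB.instance Definition _ := GRing.PzSemiRing_isNonZero.Build (quot P) quot_prime_neq0.
End QuotientByPrime.

Section ResidueField.
Variables (R : comPzRingType) (m : maxIdeal R).

Definition residue_field : Type := quot m.
HB.instance Definition _ := GRing.ComNzRing.on residue_field.

Fact residue_invertible (x : residue_field) : x != 0 -> exists y, y * x = 1.
Proof.
have [a <-] := proj_surj x => /eqP pa0.
have na : ~ max_set m a by move=> ma; apply: pa0; exact/proj_eq0.
have [b mb] := max_closed_inv (maxIdealP m) na.
exists (proj _ b); apply/eqP; rewrite eq_sym -subr_eq0 -(rmorph1 (proj m)).
by apply/eqP; rewrite -(rmorphM (proj m)) -(rmorphB (proj m)); exact/proj_eq0.
Qed.

Definition residue_inv (x : residue_field) : residue_field :=
  if x == 0 then 0 else xget 0 [set y | y * x = 1].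

Fact residue_mulVf (x : residue_field) : x != 0 -> residue_inv x * x = 1.
Proof.
move=> x0; rewrite /residue_inv (negPf x0).
by case: xgetP => [y -> //|noy]; have [y /noy] := residue_invertible x0.
Qed.
Fact residue_inv0 : residue_inv 0 = 0.
Proof. by rewrite /residue_inv eqxx. Qed.
HB.instance Definition _ :=
  GRing.ComNzRing_isField.Build residue_field residue_mulVf residue_inv0.
End ResidueField.

Definition separably_closed (k : fieldType) : Prop :=
  forall q : {poly k}, separable_poly q -> (1 < size q)%N -> exists x, root q x.

Fact ideal_span_closed (R : comPzRingType) (A : set R) :
  ideal_closed (smallest (@ideal_closed R) A).
Proof.
split=> [I [[]]// | x y Ax Ay I [idI sAI] | a x Ax I [idI sAI]].
- by have [_ + _] := idI; apply; [apply: Ax | apply: Ay].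
- by have [_ _ +] := idI; apply; apply: Ax.
Qed.

Definition ideal_span (R : comPzRingType) (A : set R) : ideal R :=
  Ideal (ideal_span_closed A).

Definition ideal_mul (R : comPzRingType) (I J : ideal R) : ideal R :=
  ideal_span [set x * y | x in ideal_set I & y in ideal_set J].

Definition ideal_exp (R : comPzRingType) (I : ideal R) (n : nat) : ideal R :=
  iter n (ideal_mul I) (ideal_span setT).

Definition ideal_ext (R S : comPzRingType) (phi : R -> S) (J : ideal R) : ideal S :=
  ideal_span (phi @` J).

Definition noetherian (R : comPzRingType) : Prop :=
  forall I : ideal R, exists s : seq R, I = ideal_span [set` s] :> set R.

Definition local_ring (R : comPzRingType) (m : maxIdeal R) : Prop :=
  forall m' : maxIdeal R, m' = m :> set R.

Definition prime_chain (R : comPzRingType) (n : nat) (P : nat -> set R) : Prop :=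
  (forall i, (i <= n)%N -> prime_closed (P i)) /\
  (forall i, (i < n)%N -> P i `<` P i.+1).

(* The supremum is taken in \bar int, where it always exists; the dimension of *)
(* the zero ring is -oo.                                                       *)
Definition krull_dim (R : comPzRingType) : \bar int :=
  supremum -oo%E [set n%:Z%:E | n in [set n | exists P, @prime_chain R n P]].

Definition regular_local_ring (R : comPzRingType) (m : maxIdeal R) : Prop :=
  [/\ noetherian R, local_ring m
    & exists2 s : seq R, max_set m = ideal_span [set` s]
                       & krull_dim R = (size s)%:Z%:E].

Definition adic_cauchy (R : comPzRingType) (I : ideal R) (u : nat -> R) : Prop :=
  forall k, exists N, forall i j, (N <= i)%N -> (N <= j)%N ->
    ideal_set (ideal_exp I k) (u i - u j).

Definition adic_limit (R : comPzRingType) (I : ideal R) (u : nat -> R) (x : R) : Prop :=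
  forall k, exists N, forall i, (N <= i)%N -> ideal_set (ideal_exp I k) (u i - x).

Definition adic_complete (R : comPzRingType) (I : ideal R) : Prop :=
  (\bigcap_k (ideal_exp I k : set R) = [set 0]) /\
  (forall u, adic_cauchy I u -> exists x, adic_limit I u x).

Definition mixed_char (R : comPzRingType) (m : maxIdeal R) (p : nat) : Prop :=
  (forall k, k.+1%:R != 0 :> R) /\ p \in [pchar residue_field m].

Definition unramified (R : comPzRingType) (m : maxIdeal R) (p : nat) : Prop :=
  mixed_char m p /\ ~ ideal_set (ideal_exp m 2) p%:R.

Definition ramified (R : comPzRingType) (m : maxIdeal R) (p : nat) : Prop :=
  mixed_char m p /\ ideal_set (ideal_exp m 2) p%:R.

(* The coefficient of degree i is a_(n-i), with n = (size f).-1 >= 1. The first *)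
(* two conditions are those under which {poly %/ f} is the quotient by f and   *)
(* not by its default 'X.                                                      *)
Definition eisenstein (R : comNzRingType) (m : maxIdeal R) (f : {poly R}) : Prop :=
  [/\ (1 < size f)%N, f \is monic,
      forall i, (i < (size f).-1)%N -> max_set m f`_i
    & ~ ideal_set (ideal_exp m 2) f`_0].

(* Polynomial divisibility %| of the library is pseudo-divisibility over an    *)
(* integral domain, hence this one.                                            *)
Definition divides (R : comPzRingType) (x y : R) : Prop := exists z, y = z * x.

Definition prime_elt (R : comPzRingType) (x : R) : Prop :=
  [/\ x != 0, ~ divides x 1
    & forall a b, divides x (a * b) -> divides x a \/ divides x b].

Definition Spec (R : comPzRingType) : Type := primeIdeal R.
HB.instance Definition _ (R : comPzRingType) := gen_eqMixin (Spec R).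
HB.instance Definition _ (R : comPzRingType) := gen_choiceMixin (Spec R).

Section Zariski.
Variable R : comPzRingType.

Definition zero_locus (A : set R) : set (Spec R) := [set P | A `<=` prime_set P].

Definition zariski_open (U : set (Spec R)) : Prop :=
  exists A : set R, U = ~` zero_locus A.

Fact zariski_openT : zariski_open setT.
Proof.
exists setT; apply/esym; rewrite -subTset => P _ /(_ 1 I) P1.
by have [_ /(_ P1)] := primeIdealP P.
Qed.

Fact zariski_openI : setI_closed zariski_open.
Proof.
move=> _ _ [A ->] [B ->]; exists [set x * y | x in A & y in B].
rewrite -setCU; congr (~` _); apply/seteqP; split=> P /=.
- have [[_ _ PM] _ _] := primeIdealP P.
  move=> [AP|BP] _ [x Ax] [y By] <-; last exact/PM/BP.
  by rewrite mulrC; exact/PM/AP.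
- move=> ABP; apply/or_asboolP; rewrite -[_ || _]negbK negb_or.
  apply/negP => /andP[/asboolPn nA /asboolPn nB].
  have [_ _ Pprime] := primeIdealP P.
  move/existsNP: nA => [x /not_implyP[Ax nPx]].
  move/existsNP: nB => [y /not_implyP[By nPy]].
  by have /Pprime[] : prime_set P (x * y) by apply: ABP; exists x => //; exists y.
Qed.

Fact zariski_open_bigU (T : Type) (U : T -> set (Spec R)) :
  (forall i, zariski_open (U i)) -> zariski_open (\bigcup_i U i).
Proof.
move=> /choice[A UA]; exists (\bigcup_i A i).
under eq_bigcupr do rewrite UA.
rewrite -setC_bigcap; congr (~` _); apply/seteqP; split=> P /=.
- by move=> AP x [i _ Aix]; exact: (AP i I).
- by move=> AP i _ x Aix; apply: AP; exists i.
Qed.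

HB.instance Definition _ := isOpenTopological.Build (Spec R)
  zariski_openT zariski_openI zariski_open_bigU.
End Zariski.

(* The maximal ideals are the closed points: one for a local ring, none for    *)
(* the zero ring.                                                              *)
Definition punctured_spec (R : comPzRingType) : set (Spec R) :=
  [set P | ~ max_closed (prime_set P)].
Arguments punctured_spec R : clear implicits.

(* Main.v *)
(* The extension R -> S = R[X]/(f) is free of finite rank. If M is the matrix, *)
(* on the generators 1, X, ..., X^(k-1), of multiplication by y in IS, then M   *)
(* may be taken with entries in I, and det(c - M) = c^k mod I, while det(c - M) *)
(* lies in every ideal of S containing c - y. Hence the contraction to R of     *)
(* Q + IS is nil modulo I whenever the contraction of Q lies in I. This gives   *)
(* lying over and going up, and with incomparability (the constant term of a    *)
(* minimal integral equation modulo Q) it yields (3). All of it passes to       *)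
(* R/J -> S/JS, whose kernel is nil by the same argument. For (4), contraction  *)
(* of primes is then continuous and maps the punctured spectrum of S/JS onto    *)
(* that of R/J. For (1), evaluation at X = 0 shows that the maximal ideal of S  *)
(* is {g | g(0) in m}, so the residue fields agree. For (2), PS consists of the *)
(* classes of the polynomials divisible by f modulo P.                          *)
Require Import Defs.
From HB Require Import structures.
From mathcomp Require Import all_boot all_order all_algebra all_field.
From mathcomp Require Import generic_quotient qpoly separable.
From mathcomp Require Import boolp classical_sets constructive_ereal.
From mathcomp Require Import topology.

Set Implicit Arguments.
Unset Strict Implicit.
Unset Printing Implicit Defensive.

Import Order.TTheory GRing.Theory.
Local Open Scope ring_scope.
Local Open Scope classical_set_scope.

(** * Ideals *)

(** Everything rests on [contraction_expr], a Cayley-Hamilton argument: if c is congruent to an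
    element of IS modulo K, and K contracts into I, then some power of c lies in I. With K = 0 it
    shows that R/J -> S/JS has nil kernel; with I a prime P it keeps PS + K away from the image of
    the complement of P, so that [prime_avoiding] yields a prime over P containing K
    ([finite_lying_over]). Together with [finite_incomparability], prime chains lift and contract
    strictly, and maximal ideals correspond to maximal ideals. Hence the dimensions agree, and the
    punctured spectrum downstairs is a continuous image of the one upstairs. *)

Section IdealTheory.
Variable R : comPzRingType.
Implicit Types I : set R.

Lemma ideal_closed_sum I (T : Type) (r : seq T) (Q : pred T) (F : T -> R) :
  ideal_closed I -> (forall i, Q i -> I (F i)) -> I (\sum_(i <- r | Q i) F i).
Proof. by move=> [I0 ID _] IF; apply: big_ind. Qed.

Lemma ideal_closedN I x : ideal_closed I -> I x -> I (- x).
Proof. by move=> [_ _ IM] Ix; rewrite -mulN1r; exact: IM. Qed.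

Lemma ideal_closedB I x y : ideal_closed I -> I x -> I y -> I (x - y).
Proof.
by move=> idI Ix Iy; have [_ ID _] := idI; apply: ID => //;
exact: ideal_closedN.
Qed.

Lemma ideal_closed0 : ideal_closed [set 0 : R].
Proof. by split=> // [x y|a x] -> => [->|]; rewrite ?addr0 ?mulr0. Qed.

Lemma ideal_closed_add I J :
  ideal_closed I -> ideal_closed J ->
  ideal_closed [set z | exists2 x, I x & J (z - x)].
Proof.
move=> idI idJ; have [I0 ID IM] := idI; have [J0 JD JM] := idJ; split.
- by exists 0; rewrite ?subrr.
- move=> y z [a Ia Ja] [b Ib Jb]; exists (a + b); first exact: ID.
  by rewrite opprD addrACA; exact: JD.
- move=> c z [a Ia Ja]; exists (c * a); first exact: IM.
  by rewrite -mulrBr; exact: JM.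
Qed.

Lemma prime_closedX I x k : prime_closed I -> I (x ^+ k) -> I x.
Proof.
move=> [_ I1 IM]; elim: k => [|k IH]; first by rewrite expr0.
by rewrite exprS => /IM[|/IH].
Qed.

(** Krull: an ideal maximal among those containing I and disjoint from the multiplicative set W is
    prime, and Zorn's lemma provides one. *)
Lemma prime_avoiding I (W : set R) :
  ideal_closed I -> W 1 -> (forall x y, W x -> W y -> W (x * y)) ->
  (forall x, I x -> ~ W x) ->
  exists Q, [/\ prime_closed Q, I `<=` Q & forall x, Q x -> ~ W x].
Proof.
move=> idI W1 WM IW.
(* set0 is admitted as the union of the empty chain.                           *)
pose good (Q : set R) := [/\ ideal_closed Q, I `<=` Q & forall x, Q x -> ~ W x].
have [F FP totF|Q [Qgood Qmax]] := @Zorn_bigcup R [set Q | Q = set0 \/ good Q].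
  have [[X0 FX0 X0n0]|F0] := pselect (exists2 X, F X & X <> set0); last first.
    left; rewrite -subset0 => x [X FX Xx].
    by case: F0; exists X => // X0; rewrite X0 in Xx.
  have goodF X x : F X -> X x -> good X.
    by move=> FX Xx; have [X_0|//] := FP X FX; rewrite X_0 in Xx.
  have [//|[idX0 IX0 _]] := FP X0 FX0.
  have [X00 _ _] := idX0.
  right; split; first split.
  - by exists X0.
  - move=> x y [X FX Xx] [Y FY Yy].
    have [/(_ _ Xx) Yx|/(_ _ Yy) Xy] := totF X Y FX FY.
      by exists Y => //; have [[_ + _] _ _] := goodF _ _ FY Yy; apply.
    by exists X => //; have [[_ + _] _ _] := goodF _ _ FX Xx; apply.
  - move=> a x [X FX Xx]; exists X => //.
    by have [[_ _ +] _ _] := goodF _ _ FX Xx; apply.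
  - by move=> x Ix; exists X0 => //; exact: IX0.
  - by move=> x [X FX Xx]; have [_ _] := goodF _ _ FX Xx; apply.
have [idQ IQ QW] : good Q.
  case: Qgood => // Q0; have [I0 _ _] := idI.
  case: (Qmax I); first by rewrite Q0; split=> [_ []|/(_ 0 I0)].
  by right; split.
exists Q; split=> //; split=> //; first by move=> /QW.
have [Q0 _ QM] := idQ.
have meetW x : ~ Q x -> exists a, exists2 q, Q q & W (a * x + q).
  (* J is Q + (x), strictly larger than Q, so by maximality of Q it meets W. *)
  move=> nQx; pose J := [set z | exists2 q, Q q & exists a, z - q = a * x].
  have idJ : ideal_closed J.
    apply: (@ideal_closed_add Q [set z | exists a, z = a * x]) => //; split.
    - by exists 0; rewrite mul0r.
    - by move=> y z [a ->] [b ->]; exists (a + b); rewrite mulrDl.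
    - by move=> c y [a ->]; exists (c * a); rewrite mulrA.
  have QJ : Q `<=` J.
    by move=> z Qz; exists z => //; exists 0; rewrite subrr mul0r.
  apply: contrapT => nW; case: (Qmax J).
    split=> // /(_ x) JQ; apply/nQx/JQ; exists 0 => //.
    by exists 1; rewrite subr0 mul1r.
  right; split=> // [y /IQ/QJ //|y [q Qq [a yq]] Wy].
  by apply: nW; exists a; exists q => //; rewrite -yq subrK.
move=> x y Qxy; apply/or_asboolP; rewrite -[_ || _]negbK negb_or.
apply/negP => /andP[/asboolPn/meetW[a [q Qq Wx]] /asboolPn/meetW[b [r Qr Wy]]].
apply: (QW _ _ (WM _ _ Wx Wy)).
have -> : (a * x + q) * (b * y + r) =
    a * b * (x * y) + (a * x + q) * r + b * y * q.
  rewrite mulrDr mulrDl -!addrA; congr (_ + _); first by rewrite mulrACA.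
  by rewrite addrC [q * _]mulrC.
by have [_ QD _] := idQ; apply: (QD) (QM _ _ Qq); apply: QD; exact: QM.
Qed.

End IdealTheory.

Section Comap.
Variables (R S : comPzRingType) (phi : {rmorphism R -> S}).

Lemma ideal_closed_comap (I : set S) :
  ideal_closed I -> ideal_closed (phi @^-1` I).
Proof.
move=> [I0 ID IM]; split=> [|x y|a x] /=.
- by rewrite rmorph0.
- by rewrite rmorphD; exact: ID.
- by rewrite rmorphM; exact: IM.
Qed.

Lemma prime_closed_comap (P : set S) :
  prime_closed P -> prime_closed (phi @^-1` P).
Proof.
move=> [/ideal_closed_comap idP P1 PM]; split=> //= [|x y]; rewrite ?rmorph1//.
by rewrite rmorphM => /PM.
Qed.

Lemma mem_ideal_ext (J : ideal R) x :
  ideal_set J x -> ideal_set (ideal_ext phi J) (phi x).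
Proof. by move=> Jx I [_]; apply; exists x. Qed.

Lemma ideal_ext_sub (J : ideal R) (I : set S) :
  ideal_closed I -> (forall x, ideal_set J x -> I (phi x)) ->
  ideal_ext phi J `<=` I.
Proof. by move=> idI JI x; apply; split=> // _ [y Jy <-]; exact: JI. Qed.

End Comap.

Section QuotMap.
Variables (R S : comPzRingType) (phi : {rmorphism R -> S}).
Variables (I : ideal R) (J : ideal S).
Hypothesis phiIJ : forall x, ideal_set I x -> ideal_set J (phi x).

(* The unused proof argument is what the morphism instances below depend on.   *)
Definition quot_map (_ : forall x, ideal_set I x -> ideal_set J (phi x))
  (x : quot I) : quot J :=
  proj J (phi (repr x)).

Lemma quot_map_proj x : quot_map phiIJ (proj I x) = proj J (phi x).
Proof.
apply/quot_eqP; rewrite -rmorphB; apply: phiIJ; apply/quot_eqP.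
by rewrite reprK.
Qed.

Fact quot_map_zmod_morphism : zmod_morphism (quot_map phiIJ).
Proof.
move=> x y; have [a <-] := proj_surj x; have [b <-] := proj_surj y.
by rewrite -(rmorphB (proj I)) !quot_map_proj (rmorphB phi) (rmorphB (proj J)).
Qed.

Fact quot_map_monoid_morphism : monoid_morphism (quot_map phiIJ).
Proof.
split=> [|x y].
  by rewrite -(rmorph1 (proj I)) quot_map_proj (rmorph1 phi) (rmorph1 (proj J)).
have [a <-] := proj_surj x; have [b <-] := proj_surj y.
by rewrite -(rmorphM (proj I)) !quot_map_proj (rmorphM phi) (rmorphM (proj J)).
Qed.

HB.instance Definition _ := GRing.isZmodMorphism.Build (quot I) (quot J)
  (quot_map phiIJ) quot_map_zmod_morphism.
HB.instance Definition _ := GRing.isMonoidMorphism.Build (quot I) (quot J)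
  (quot_map phiIJ) quot_map_monoid_morphism.

End QuotMap.

(** * Module-finite morphisms *)

(** Having 1 as the first generator makes det B the first entry of adj B * B * e, so the determinant
    trick gives det B itself. *)
Definition module_finite (R S : comPzRingType) (phi : R -> S) : Prop :=
  exists k (e : 'cV[S]_k.+1),
    e 0 0 = 1 /\ forall s, exists c : 'rV[R]_k.+1, s = (map_mx phi c *m e) 0 0.

Lemma module_finite_quot_map (R S : comPzRingType) (phi : {rmorphism R -> S})
    (I : ideal R) (J : ideal S)
    (phiIJ : forall x, ideal_set I x -> ideal_set J (phi x)) :
  module_finite phi -> module_finite (quot_map phiIJ).
Proof.
move=> [k [e [e0 gen_e]]]; exists k, (map_mx (proj J) e); split.
  by rewrite mxE e0 rmorph1.
move=> s; have [t <-] := proj_surj s; have [c ->] := gen_e t.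
exists (map_mx (proj I) c).
rewrite !mxE rmorph_sum; apply: eq_bigr => i _.
by rewrite !mxE (rmorphM (proj J)) quot_map_proj.
Qed.

Section DeterminantTrick.
Variables (R S : comPzRingType) (phi : {rmorphism R -> S}) (k : nat).
Variable e : 'cV[S]_k.+1.
Hypothesis e0 : e 0 0 = 1.
Hypothesis gen_e :
  forall s, exists c : 'rV[R]_k.+1, s = (map_mx phi c *m e) 0 0.

Lemma mul_generators s : exists M : 'M[R]_k.+1, s *: e = map_mx phi M *m e.
Proof.
have /fin_all_exists[c sc] i := gen_e (s * e i 0).
exists (\matrix_i c i); apply/colP => i.
rewrite mxE sc !mxE; by apply: eq_bigr => j _; rewrite !mxE.
Qed.

(** The elements y admitting such a matrix form an ideal of S that contains the image of I, through
    scalar matrices. *)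
Lemma ideal_ext_mul_generators (I : ideal R) y :
  ideal_set (ideal_ext phi I) y ->
  exists2 M : 'M[R]_k.+1,
    forall i j, ideal_set I (M i j) & y *: e = map_mx phi M *m e.
Proof.
have [I0 ID IM] := idealP I.
pose A := [set y | exists2 M : 'M[R]_k.+1,
  forall i j, ideal_set I (M i j) & y *: e = map_mx phi M *m e].
apply: (@ideal_ext_sub _ _ phi I A); first split.
- by exists 0 => [i j|]; rewrite ?mxE // scale0r map_mx0 mul0mx.
- move=> a b [M MI aM] [N NI bN]; exists (M + N) => [i j|].
    by rewrite mxE; exact: ID.
  by rewrite scalerDl map_mxD mulmxDl aM bN.
- move=> s a [M MI aM]; have [N sN] := mul_generators s.
  exists (N *m M) => [i j|].
    rewrite mxE; apply: ideal_closed_sum (idealP I) _ => l _; exact: IM.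
  by rewrite map_mxM -mulmxA -aM -scalemxAr -sN scalerA mulrC.
- move=> x Ix; exists x%:M => [i j|].
    by rewrite mxE; case: eqP => _; rewrite ?mulr1n ?mulr0n.
  by rewrite map_scalar_mx mul_scalar_mx.
Qed.

Lemma det_mem_ideal (K : set S) (B : 'M[S]_k.+1) :
  ideal_closed K -> (forall i, K ((B *m e) i 0)) -> K (\det B).
Proof.
move=> idK BeK; have [_ _ KM] := idK.
have -> : \det B = (\adj B *m (B *m e)) 0 0.
  by rewrite mulmxA mul_adj_mx mul_scalar_mx mxE e0 mulr1.
by rewrite mxE; apply: ideal_closed_sum idK _ => i _; exact: KM.
Qed.

Lemma det_scalar_sub (I : ideal R) (M : 'M[R]_k.+1) c :
  (forall i j, ideal_set I (M i j)) ->
  ideal_set I (\det (c%:M - M) - c ^+ k.+1).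
Proof.
move=> MI; apply/quot_eqP; rewrite -!/(proj I _).
rewrite -det_map_mx map_mxB map_scalar_mx /=.
have -> : map_mx (proj I) M = 0.
  by apply/matrixP => i j; rewrite !mxE; exact/proj_eq0.
by rewrite subr0 det_scalar rmorphXn.
Qed.

(** With M representing y and entries in I, (c - M) e = (c - y) e has entries in K, so det(c - M)
    lies in K, hence in I; modulo I it equals the power of c. *)
Lemma contraction_expr (I : ideal R) (K : set S) c y :
  ideal_closed K -> (forall x, K (phi x) -> ideal_set I x) ->
  ideal_set (ideal_ext phi I) y -> K (phi c - y) -> ideal_set I (c ^+ k.+1).
Proof.
move=> idK KI /ideal_ext_mul_generators[M MI yM] Kcy.
have [_ _ KM] := idK.
have Idet : ideal_set I (\det (c%:M - M)).
  apply: KI; rewrite -det_map_mx map_mxB map_scalar_mx.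
  apply: det_mem_ideal idK _ => i.
  rewrite mulmxBl -yM mul_scalar_mx -scalerBl mxE mulrC; exact: KM.
rewrite -[_ ^+ _](subKr (\det (c%:M - M))).
by apply: ideal_closedB (idealP I) Idet _; exact: det_scalar_sub.
Qed.

End DeterminantTrick.

Lemma module_finite_integral (R S : comNzRingType) (phi : {rmorphism R -> S}) s :
  module_finite phi -> integralOver phi s.
Proof.
move=> [k [e [e0 gen_e]]]; have [M sM] := mul_generators gen_e s.
exists (char_poly M); first exact: char_poly_monic.
rewrite map_char_poly rootE -horner_evalE -det_map_mx; apply/eqP.
(* The zero ideal plays K: s - M kills the generators, so its determinant vanishes. *)
have : [set 0] (\det (s%:M - map_mx phi M)).
  apply: det_mem_ideal e0 _ _ (@ideal_closed0 _) _ => i.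
  by rewrite mulmxBl -sM mul_scalar_mx subrr mxE.
move=> /= <-; congr (\det _); apply/matrixP => i j.
by rewrite !mxE /horner_eval !hornerE hornerMn hornerX.
Qed.

(** * Lying over, going up and incomparability *)

Section FiniteMorphism.
Variables (R S : comPzRingType) (phi : {rmorphism R -> S}).
Hypothesis fin_phi : module_finite phi.

Lemma finite_contraction_expr (I : ideal R) (K : set S) :
  ideal_closed K -> (forall x, K (phi x) -> ideal_set I x) ->
  exists k, forall c y,
    ideal_set (ideal_ext phi I) y -> K (phi c - y) -> ideal_set I (c ^+ k).
Proof.
move=> idK KI; have [k [e [e0 gen_e]]] := fin_phi.
exists k.+1 => c y; exact: (contraction_expr e0 gen_e idK KI).
Qed.

(** K = 0 gives lying over when the kernel is nil; K a prime gives going up. *)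
Lemma finite_lying_over (P : primeIdeal R) (K : set S) :
  ideal_closed K -> (forall x, K (phi x) -> prime_set P x) ->
  exists Q, [/\ prime_closed Q, K `<=` Q & phi @^-1` Q = prime_set P].
Proof.
move=> idK KP; have [k PX] := @finite_contraction_expr P K idK KP.
have [[P0 _ _] P1 PM] := primeIdealP P.
have [K0 _ _] := idK.
(* I is PS + K. A prime containing it and avoiding the image of the complement of P contracts
   exactly to P. *)
pose I := [set z | exists2 y, ideal_set (ideal_ext phi P) y & K (z - y)].
have [|||x Ix Wx|Q [primeQ IQ QW]] :=
  @prime_avoiding S I (phi @` ~` prime_set P).
- exact: ideal_closed_add (idealP _) idK.
- by exists 1; rewrite ?rmorph1.
- move=> _ _ [x nPx <-] [y nPy <-]; exists (x * y); last by rewrite rmorphM.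
  by move=> Pxy; case: (PM _ _ Pxy).
- case: Wx Ix => c nPc <- [y Py Kcy]; apply: nPc.
  exact: prime_closedX (primeIdealP P) (PX _ _ Py Kcy).
- exists Q; split=> // [z Kz|]; first apply: IQ.
    by exists 0; rewrite ?subr0 //; have [] := idealP (ideal_ext phi P).
  apply/seteqP; split=> x /=.
    by move=> Qx; apply: contrapT => nPx; apply: (QW _ Qx); exists x.
  move=> Px; apply: IQ; exists (phi x); rewrite ?subrr //.
  exact: (@mem_ideal_ext _ _ phi P).
Qed.

(** An element s of I satisfies a monic equation h(s) s + r = 0 modulo Q. Since s is in I, so is r,
    hence r is in Q; then s or h(s) is in Q, and h is monic of smaller degree. Induction on the
    polynomial ends at the constant 1, which has no root. *)
Lemma finite_incomparability (Q I : set S) :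
  prime_closed Q -> ideal_closed I -> Q `<=` I ->
  (forall x, I (phi x) -> Q (phi x)) -> I `<=` Q.
Proof.
move=> primeQ idI QI IQ s Is.
have [[Q0 QD _] _ QM] := primeQ; have [_ _ IM] := idI.
pose Q' := PrimeIdeal primeQ.
pose P := PrimeIdeal (prime_closed_comap phi primeQ).
have phiPQ x : ideal_set P x -> ideal_set Q' (phi x) by [].
pose psi : {rmorphism quot P -> quot Q'} := quot_map phiPQ.
have [g] : integralOver psi (proj Q' s).
  exact/module_finite_integral/module_finite_quot_map.
elim/poly_ind: g => [|h c IH].
  by rewrite monicE lead_coef0 eq_sym oner_eq0.
have [-> | h0 mon_g] := eqVneq h 0.
  rewrite mul0r add0r monicE lead_coefC => /eqP ->.
  by rewrite rmorph1 /root hornerC oner_eq0.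
have mon_h : h \is monic.
  move: mon_g; rewrite !monicE lead_coefDl ?lead_coefMX //.
  rewrite size_mulX // size_polyC ltnS (leq_trans (leq_b1 _)) //.
  by rewrite size_poly_gt0.
rewrite /root rmorphD rmorphM /= map_polyX map_polyC hornerMXaddC => /eqP.
have [t tE] := proj_surj (map_poly psi h).[proj Q' s].
have [r <-] := proj_surj c; rewrite -tE /psi /= quot_map_proj.
rewrite -rmorphM -rmorphD => /proj_eq0 /= Qtsr.
have Qr : Q (phi r).
  apply: IQ; rewrite -[phi r](addKr (t * s)) addrC.
  by apply: ideal_closedB idI _ _; [exact: QI | exact: IM].
have /QM[Qt|//] : Q (t * s).
  rewrite -[t * s](addrK (phi r)); apply: ideal_closedB Qtsr Qr.
  by have [] := primeQ.
by apply: IH => //; rewrite /root -tE; apply/eqP/proj_eq0.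
Qed.

End FiniteMorphism.

(** * Spectra *)

Lemma Spec_inj (R : comPzRingType) (P Q : Spec R) :
  prime_set P = prime_set Q -> P = Q.
Proof.
case: P Q => [P primeP] [Q primeQ] /= eqPQ; subst Q.
congr PrimeIdeal; exact: Prop_irrelevance.
Qed.

Definition Spec_map (R S : comPzRingType) (phi : {rmorphism R -> S})
  (Q : Spec S) : Spec R :=
  PrimeIdeal (prime_closed_comap phi (primeIdealP Q)).

Lemma continuous_Spec_map (R S : comPzRingType) (phi : {rmorphism R -> S}) :
  continuous (Spec_map phi).
Proof.
apply/continuousP => _ [A ->]; exists (phi @` A).
rewrite preimage_setC; congr (~` _); apply/seteqP; split=> Q /=.
  by move=> AQ _ [x Ax <-]; exact: AQ.
by move=> AQ x Ax; apply: AQ; exists x.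
Qed.

Section FiniteMorphismSpec.
Variables (R S : comPzRingType) (phi : {rmorphism R -> S}).
Hypothesis fin_phi : module_finite phi.

(** Upwards this is incomparability. Downwards, if I contains the contraction of Q and some x whose
    image is outside Q, then 1 lies in IS + Q, so [finite_contraction_expr] puts 1 in I. *)
Lemma finite_max_comap (Q : set S) :
  prime_closed Q -> max_closed (phi @^-1` Q) <-> max_closed Q.
Proof.
move=> primeQ; have [idQ Q1 _] := primeQ; split=> maxQ.
- split=> // I idI I1 QI; have [_ _ maxP] := maxQ.
  apply/seteqP; split=> //.
  apply: (finite_incomparability fin_phi primeQ idI QI).
  suff eqI : phi @^-1` I = phi @^-1` Q.
    by move=> x; rewrite -[I _]/((phi @^-1` I) x) eqI.
  apply: maxP => [||x]; first exact: ideal_closed_comap.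
    by rewrite /= rmorph1.
  exact: QI.
- split=> [||I idI I1 PI]; [exact: ideal_closed_comap | by rewrite /= rmorph1|].
  apply/seteqP; split=> // x Ix; apply: contrapT => nQx; apply: I1.
  have [a Qa] := max_closed_inv maxQ nQx.
  have [k IX] := finite_contraction_expr fin_phi (I := Ideal idI) idQ PI.
  rewrite -(expr1n _ k); apply: IX (a * phi x) _ _; last by rewrite rmorph1.
  have [_ _ + ] := idealP (ideal_ext phi (Ideal idI)); apply.
  exact: (@mem_ideal_ext _ _ phi (Ideal idI)).
Qed.

Hypothesis nil_ker : forall x, phi x = 0 -> exists k, x ^+ k = 0.

Lemma finite_Spec_map_surj (P : primeIdeal R) :
  exists2 Q, prime_closed Q & phi @^-1` Q = prime_set P.
Proof.
have [x /nil_ker[k xk0]|Q [primeQ _ QP]] :=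
  finite_lying_over fin_phi (P := P) (@ideal_closed0 S).
  apply: (prime_closedX (k := k) (primeIdealP P)); rewrite xk0.
  by have [[]] := primeIdealP P.
by exists Q.
Qed.

(** Lying over starts the chain and going up extends it. The contraction of the top prime is kept in
    the induction, as going up needs it; strictness is inherited from the contractions. *)
Lemma finite_lift_chain k (P : nat -> set R) : prime_chain k P ->
  exists2 Q, prime_chain k Q & phi @^-1` (Q k) = P k.
Proof.
elim: k P => [|k IH] P [primeP ltP].
  have [Q primeQ QP] := finite_Spec_map_surj (PrimeIdeal (primeP 0 isT)).
  by exists (fun=> Q).
have [|Q [primeQ ltQ] QP] := IH P.
  by split=> i ik; [apply: primeP; exact: leqW | apply: ltP; exact: leqW].
have [PSP nPSP] := ltP k (leqnn _).
have [||Q' [primeQ' QQ' Q'P]] := finite_lying_over fin_phi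
    (P := PrimeIdeal (primeP k.+1 (leqnn _))) (K := Q k).
- by have [] := primeQ k (leqnn _).
- by move=> x Qx; apply: PSP; rewrite -QP.
exists (fun i => if (i <= k)%N then Q i else Q'); last by rewrite ltnn.
split=> i; first by case: ifP => [ik _|_ _]; [exact: primeQ|].
rewrite ltnS; case: ltngtP => // [ik _|-> _]; first exact: ltQ.
split=> // Q'Q; apply: nPSP.
by rewrite -QP -[P k.+1]Q'P => x; exact: Q'Q.
Qed.

Lemma finite_krull_dim : krull_dim S = krull_dim R.
Proof.
rewrite /krull_dim; congr (supremum _ (image _ _)); apply/seteqP; split=> k [P].
  move=> [primeP ltP]; exists (fun i => phi @^-1` P i); split=> i ik.
    by apply: prime_closed_comap; exact: primeP.
  have [PSP nPSP] := ltP i ik; split=> [x|sub]; first exact: PSP.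
  apply: nPSP; apply: (finite_incomparability fin_phi _ _ PSP) => //.
    by apply: primeP; exact: ltnW.
  by have [] := primeP i.+1 ik.
by move=> /finite_lift_chain[Q]; exists Q.
Qed.

Lemma finite_punctured_spec :
  Spec_map phi @` (@punctured_spec S) = @punctured_spec R.
Proof.
apply/seteqP; split=> [_ [Q nmaxQ <-]|P nmaxP].
  by move=> /(finite_max_comap (primeIdealP Q)).
have [Q primeQ QP] := finite_Spec_map_surj P.
exists (PrimeIdeal primeQ); last exact: Spec_inj.
by move=> /= /(finite_max_comap primeQ); rewrite QP.
Qed.

Lemma finite_connected_punctured_spec :
  connected (@punctured_spec S) -> connected (@punctured_spec R).
Proof.
move=> /connected_continuous_connected; rewrite -finite_punctured_spec; apply.
apply: continuous_subspaceT; exact: continuous_Spec_map.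
Qed.

End FiniteMorphismSpec.

(** * Quotients by monic polynomials *)

Section QuotientByMonic.
(** The library divides by [mk_monic f], which is f when f is monic of positive degree and the
    default X otherwise. *)
Variables (R : comNzRingType) (f : {poly R}).

Lemma qpoly_valK (g : {poly %/ f}) : in_qpoly f g = g.
Proof. apply: val_inj; exact: in_qpoly_small (size_mk_monic g). Qed.

Lemma in_qpolyC c : in_qpoly f c%:P = qpolyC f c.
Proof. exact: qpoly_valK (qpolyC f c). Qed.

Lemma qpoly_coord k (g : {poly %/ f}) : k = (size (mk_monic f)).-1 ->
  g = \sum_(i < k) qpolyC f g`_i * in_qpoly f 'X^i.
Proof.
move=> ->.
rewrite -[LHS]qpoly_valK.
have {1}-> : g = \poly_(i < (size (mk_monic f)).-1) g`_i :> {poly R}.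
  apply/polyP => i; rewrite coef_poly; case: ltnP => // le_i.
  exact: big_coef_npoly.
rewrite poly_def raddf_sum; apply: eq_bigr => i _.
by rewrite -mul_polyC /= in_qpolyM in_qpolyC.
Qed.

Lemma module_finite_qpolyC : module_finite (qpolyC f).
Proof.
have size_f : (size (mk_monic f)).-2.+1 = (size (mk_monic f)).-1.
  by have := size_mk_monic_gt1 f; case: size => [|[]].
exists (size (mk_monic f)).-2, (\col_i in_qpoly f 'X^i); split.
  by rewrite mxE expr0 in_qpoly1.
move=> g; exists (\row_i g`_i); rewrite mxE [LHS](qpoly_coord g size_f).
by apply: eq_bigr => i _; rewrite !mxE.
Qed.

Lemma qpolyC_inj : injective (qpolyC f).
Proof. by move=> a b /(congr1 val)/polyC_inj. Qed.

(** Division with remainder by a monic polynomial commutes with change of coefficients, by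
    uniqueness of the remainder. *)
Lemma in_qpoly_map_eq0 (A : comNzRingType) (phi : {rmorphism R -> A})
    (g : {poly R}) :
  map_poly phi (in_qpoly f g) = 0 <->
  divides (map_poly phi (mk_monic f)) (map_poly phi g).
Proof.
have mon_f := monic_mk_monic f.
have mon_phif : map_poly phi (mk_monic f) \is monic by exact: monic_map.
have gE := Pdiv.RingMonic.rdivp_eq mon_f g.
pose q := Pdiv.CommonRing.rdivp g (mk_monic f).
split=> [r0|[z zE]].
  exists (map_poly phi q).
  by rewrite {1}gE rmorphD rmorphM /= [X in _ + X]r0 addr0.
set r := map_poly phi _.
have : r = (z - map_poly phi q) * map_poly phi (mk_monic f).
  by rewrite mulrBl -zE [in LHS]/r {2}gE rmorphD rmorphM /= addrC addKr.
(* r is a multiple of the image of f, so its remainder is 0; it is also shorter than that image, so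
   it is its own remainder. *)
move=> /(congr1 (fun p => Pdiv.CommonRing.rmodp p (map_poly phi (mk_monic f)))).
rewrite Pdiv.RingMonic.rmodp_mull // Pdiv.CommonRing.rmodp_small //.
have -> : size (map_poly phi (mk_monic f)) = size (mk_monic f).
  by apply: size_map_poly_id0; rewrite (monicP mon_f) rmorph1 oner_eq0.
by apply: leq_ltn_trans (size_poly _ _) _; exact: size_mk_monic.
Qed.

Lemma ideal_ext_qpolyC (P : primeIdeal R) (g : {poly %/ f}) :
  ideal_set (ideal_ext (qpolyC f) P) g <-> map_poly (proj P) g = 0.
Proof.
split=> [|g0].
- pose I := [set g : {poly %/ f} | map_poly (proj P) g = 0].
  apply: (@ideal_ext_sub _ _ (qpolyC f) P I); first split=> /=.
  + by rewrite /I /= map_poly0.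
  + by move=> x y /= x0 y0; rewrite /I /= rmorphD /= x0 y0 addr0.
  + move=> a x /= x0; apply/in_qpoly_map_eq0; exists 0.
    by rewrite rmorphM /= x0 mulr0 mul0r.
  + by move=> x Px; rewrite /I /= map_polyC /=; have /proj_eq0 -> := Px.
- have idE := idealP (ideal_ext (qpolyC f) P); have [_ _ EM] := idE.
  rewrite [g](qpoly_coord g erefl); apply: ideal_closed_sum idE _ => i _.
  rewrite mulrC; apply: EM; apply: mem_ideal_ext; apply/proj_eq0.
  by rewrite -coef_map g0 coef0.
Qed.

Lemma prime_closed_ideal_ext (P : primeIdeal R) :
  prime_elt (map_poly (proj P) (mk_monic f)) ->
  prime_closed (ideal_set (ideal_ext (qpolyC f) P)).
Proof.
move=> [_ _ primef]; split; first exact: idealP.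
- move=> /ideal_ext_qpolyC /=; rewrite map_polyC /= rmorph1 => /eqP.
  by rewrite polyC_eq0 oner_eq0.
- move=> x y /ideal_ext_qpolyC/in_qpoly_map_eq0; rewrite rmorphM => /primef.
  case=> /in_qpoly_map_eq0; rewrite qpoly_valK => /ideal_ext_qpolyC;
    by [left | right].
Qed.

(** Since f(0) lies in m, taking the constant coefficient modulo m is a ring morphism from the
    quotient onto R/m; this set is its kernel. *)
Lemma max_closed_coef0 (m : maxIdeal R) :
  max_set m (mk_monic f)`_0 ->
  max_closed [set g : {poly %/ f} | max_set m g`_0].
Proof.
move=> mf0; have maxm := maxIdealP m; have [idm m1 _] := maxm.
have [m0 mD mM] := idm.
have coef0M_mod (x y : {poly %/ f}) : max_set m (x`_0 * y`_0 - (x * y)`_0).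
  have := Pdiv.RingMonic.rdivp_eq (monic_mk_monic f) (val x * val y).
  rewrite -coef0M => {1}->.
  by rewrite coefD addrK coef0M; exact: mM.
split=> [||I idI I1 mI].
- split=> [|x y|a x mx] /=; first by rewrite coef0.
    by rewrite coefD; exact: mD.
  rewrite -[_`_0](subKr (a`_0 * x`_0)).
  by apply: ideal_closedB idm _ (coef0M_mod _ _); exact: mM.
- by rewrite /= coefC eqxx.
- apply/seteqP; split=> // x Ix /=; apply: contrapT => nmx; apply: I1.
  have [a ma] := max_closed_inv maxm nmx; have [_ ID IM] := idI.
  rewrite -(subrK (qpolyC f a * x) 1); apply: ID; last exact: IM.
  apply: mI; rewrite /= coefB coefC eqxx -[_ - _](subrKA (a * x`_0)).
  apply: mD => //; have := coef0M_mod (qpolyC f a) x.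
  by rewrite [in X in X -> _]/= coefC eqxx.
Qed.

End QuotientByMonic.

(** * Residue fields, nil kernels and the Eisenstein extension *)

Lemma separably_closed_surj (k l : fieldType) (theta : {rmorphism k -> l}) :
  (forall y, exists x, theta x = y) -> separably_closed l -> separably_closed k.
Proof.
move=> surj sep_l q sep_q size_q.
have [||y] := sep_l (map_poly theta q).
- by rewrite separable_map.
- by rewrite size_map_poly.
- by have [x <-] := surj y; rewrite fmorph_root; exists x.
Qed.

Lemma quot_map_ideal_ext_nil_ker (R S : comPzRingType) (phi : {rmorphism R -> S})
    (J : ideal R) (x : quot J) :
  module_finite phi -> injective phi ->
  quot_map (@mem_ideal_ext _ _ phi J) x = 0 -> exists k, x ^+ k = 0.
Proof.
move=> fin_phi inj_phi; have [c <-] := proj_surj x.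
rewrite quot_map_proj => /proj_eq0 Jc.
have [J0 _ _] := idealP J.
have [y /=|k JX] := finite_contraction_expr fin_phi (I := J) (@ideal_closed0 S).
  by rewrite -(rmorph0 phi) => /inj_phi ->.
exists k; rewrite -rmorphXn; apply/proj_eq0.
by apply: JX Jc _; rewrite /= subrr.
Qed.

Theorem lemma2p1 (p d : nat) (R : comNzRingType) (m : maxIdeal R)
    (f : {poly R}) (n : maxIdeal {poly %/ f}) :
  regular_local_ring m -> krull_dim R = d%:Z%:E -> adic_complete m ->
  unramified m p ->
  eisenstein m f ->
  regular_local_ring n -> adic_complete n -> ramified n p ->
  [/\ separably_closed (residue_field n) -> separably_closed (residue_field m),
      forall P : primeIdeal R, prime_elt (map_poly (proj P) f) ->
        prime_closed (ideal_ext (qpolyC f) P),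
      forall J : ideal R,
        krull_dim (quot (ideal_ext (qpolyC f) J)) = krull_dim (quot J)
    & forall J : ideal R,
        connected (punctured_spec (quot (ideal_ext (qpolyC f) J))) ->
        connected (punctured_spec (quot J))].
Proof.
move=> _ _ _ _ [size_f mon_f mf _] [_ local_n _] _ _.
have mk_f : mk_monic f = f by rewrite /mk_monic size_f mon_f.
have fin_quot (J : ideal R) :=
  module_finite_quot_map (@mem_ideal_ext _ _ (qpolyC f) J)
    (module_finite_qpolyC f).
have nil_quot (J : ideal R) x :=
  @quot_map_ideal_ext_nil_ker _ _ (qpolyC f) J x
    (module_finite_qpolyC f) (@qpolyC_inj _ f).
split=> [|P|J|J].
- have mf0 : max_set m (mk_monic f)`_0.
    by rewrite mk_f; apply: mf; rewrite -ltnS prednK // ltnW.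
  (* S is local, so n is the maximal ideal found above. *)
  have nE : max_set n = [set g : {poly %/ f} | max_set m g`_0] :=
    esym (local_n (MaxIdeal (max_closed_coef0 mf0))).
  have mn x : ideal_set m x -> ideal_set n (qpolyC f x).
    by move=> mx; rewrite /= nE /= coefC eqxx.
  pose theta : {rmorphism residue_field m -> residue_field n} := quot_map mn.
  apply: (@separably_closed_surj _ _ theta) => y.
  (* g minus its constant coefficient has constant coefficient 0, so both have the same class modulo
     n. *)
  have [g <-] := @proj_surj _ n y; exists (proj m g`_0).
  rewrite /theta /= quot_map_proj; apply/quot_eqP.
  rewrite /= nE /= coefB coefC eqxx subrr.
  by have [[]] := maxIdealP m.
- by rewrite -{1}mk_f; exact: prime_closed_ideal_ext.
- exact: finite_krull_dim (fin_quot J) (nil_quot J).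
- exact: finite_connected_punctured_spec (fin_quot J) (nil_quot J).
Qed.
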